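(* The Behrend position of a convex body is unique up to orthogonal transformations, scalings, and translations. That is, if $K\subset\mathbb{R}^n$ is a convex body and $A,B\in\mathrm{GL}_n(\mathbb{R})$ are such that both $AK$ and $BK$ are in Behrend position, then there exist an orthogonal transformation $Q\in\mathrm{O}(n)$, a scalar $\rho>0$, and a vector $t\in\mathbb{R}^n$ such that $BK=\rho\,Q(AK)+t$.
   Context: A convex body in $\mathbb{R}^n$ is a compact convex set with nonempty interior. $\mathrm{D}(K)=\max\{\|x-y\|:x,y\in K\}$ is the Euclidean diameter, $\mathrm{vol}$ the $n$-dimensional volume, and $\operatorname{idq}(K)=\mathrm{vol}(K)/\mathrm{D}(K)^n$. A convex body $K$ is in Behrend position if $\operatorname{idq}(K)=\max_{A\in \mathrm{GL}_n(\mathbb{R})}\operatorname{idq}(AK)$. *)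

(* Defs.v *)
From mathcomp Require Import all_boot all_order all_algebra.
From mathcomp Require Import all_classical all_reals all_analysis.

Set Implicit Arguments.
Unset Strict Implicit.
Unset Printing Implicit Defensive.

Import Order.TTheory GRing.Theory Num.Theory numFieldNormedType.Exports.

Local Open Scope classical_set_scope.
Local Open Scope ring_scope.

(* Points of R^n are column vectors 'cV[R]_n.  The library's norm on matrices
   is the sup norm, so the Euclidean norm is defined here; both induce the
   library's topology on 'cV[R]_n, used below for compactness and interior. *)
Definition euclid_norm (R : realType) (n : nat) (v : 'cV[R]_n) : R :=
  Num.sqrt (\sum_(i < n) v i 0 ^+ 2).

Definition convex_body (R : realType) (n : nat) (K : set 'cV[R]_n) : Prop :=
  [/\ compact K, convex_set K & K° !=set0].

(* For a nonempty compact K this supremum is attained, hence a maximum. *)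
Definition diameter (R : realType) (n : nat) (K : set 'cV[R]_n) : R :=
  sup [set euclid_norm (x - y) | x in K & y in K].

(* The n-fold product of the Lebesgue measure of R, on n-tuples; R^0 is a
   point of mass 1. *)
Fixpoint lebesgue_tuple (R : realType) (n : nat) :
    set (n.-tuple (measurableTypeR R)) -> \bar R :=
  if n is m.+1 then
    pushforward (lebesgue_measure \x @lebesgue_tuple R m)%E
      (fun p => [the m.+1.-tuple (measurableTypeR R) of p.1 :: p.2])
  else \d_[tuple].

Definition volume (R : realType) (n : nat) (K : set 'cV[R]_n) : \bar R :=
  lebesgue_tuple
    [set t : n.-tuple (measurableTypeR R) | K (\col_(i < n) tnth t i)].

(* Convex bodies have finite volume, so fine loses nothing on them. *)
Definition idq (R : realType) (n : nat) (K : set 'cV[R]_n) : R :=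
  fine (volume K) / diameter K ^+ n.

Definition linear_image (R : realType) (n : nat) (A : 'M[R]_n)
    (K : set 'cV[R]_n) : set 'cV[R]_n := [set A *m x | x in K].

Definition is_max (R : realType) (S : set R) (m : R) : Prop :=
  S m /\ ubound S m.

Definition behrend_position (R : realType) (n : nat) (K : set 'cV[R]_n) : Prop :=
  convex_body K /\
  is_max [set idq (linear_image A K) | A in [set A : 'M[R]_n | A \in unitmx]]
    (idq K).

Definition orthogonal_mx (R : realType) (n : nat) (Q : 'M[R]_n) : Prop :=
  Q^T *m Q = 1%:M.

(* Main.v *)
From HB Require Import structures.
Require Import Defs.
From mathcomp Require Import all_boot all_order all_algebra perm.
From mathcomp Require Import all_classical all_reals all_analysis.
From mathcomp Require Import measurable_realfun ring lra.

(* If AK and BK are both in Behrend position, put L = AK and rescale B A^-1 to a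
   matrix M with |det M| = 1 and diam (M L) = diam L.  For a permutation matrix
   P write M P = Q^T U with Q orthogonal and U upper triangular with nonnegative
   diagonal u.  The matrix N = (Q^T P^T + M) / 2 does not increase the diameter of
   L by the triangle inequality, so |det N| <= 1 by maximality, whereas
   |det N| = prod (1 + u_i) / 2 and prod u_i = 1; the equality case of AM-GM
   gives u_i = 1 for all i.  Choosing P to bring the i-th column in front shows
   that every column of M has norm u_0 = 1; for P = 1 the columns of U then have
   norm 1 and diagonal entry 1, so that U = 1 and M is orthogonal.

   The formula vol (M K) = |det M| vol K follows by induction on the dimension:
   it holds for block lower triangular matrices by Fubini and translation
   invariance and for the exchange of the first two coordinates by Tonelli, and
   these matrices generate GL_n. *)

Set Implicit Arguments.
Unset Strict Implicit.
Unset Printing Implicit Defensive.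

Import Order.TTheory GRing.Theory Num.Theory numFieldNormedType.Exports.

Local Open Scope classical_set_scope.
Local Open Scope ring_scope.

(** * Volume of sets of column vectors, computed by slices *)

Definition col_of_tuple (R : realType) (n : nat)
    (t : n.-tuple (measurableTypeR R)) : 'cV[R]_n := \col_(i < n) tnth t i.

(** Measurability and volume are read off on tuples, which carry the product sigma-algebra. *)
Definition measurable_col (R : realType) (n : nat) (K : set 'cV[R]_n) : Prop :=
  measurable (@col_of_tuple R n @^-1` K).

Lemma volumeE (R : realType) (n : nat) (K : set 'cV[R]_n) :
  volume K = lebesgue_tuple (@col_of_tuple R n @^-1` K).
Proof. by []. Qed.

(** The map [f] factors through the tuple of its coordinates, which is measurable because each
    coordinate is. *)
Lemma measurable_col_preimage (R : realType) d (T : measurableType d) (n : nat)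
    (f : T -> 'cV[R]_n) (K : set 'cV[R]_n) :
  (forall i, measurable_fun setT (fun x => f x i 0 : measurableTypeR R)) ->
  measurable_col K -> measurable (f @^-1` K).
Proof.
move=> mf mK.
pose g x : n.-tuple (measurableTypeR R) := [tuple f x i 0 | i < n].
have -> : f @^-1` K = g @^-1` (@col_of_tuple R n @^-1` K).
  rewrite -comp_preimage; congr (_ @^-1` K); apply/funext => x /=.
  by apply/matrixP => i j; rewrite !mxE tnth_mktuple ord1.
have mg : measurable_fun setT g.
  apply/measurable_fun_tnthP => i /=.
  rewrite (_ : _ \o _ = fun x => f x i 0) //.
  by apply/funext => x /=; rewrite tnth_mktuple.
by rewrite -[X in measurable X]setTI; exact: mg.
Qed.

Lemma measurable_coord (R : realType) (n : nat) (i : 'I_n) :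
  measurable_fun setT
    (fun t => @col_of_tuple R n t i 0 : measurableTypeR R).
Proof.
rewrite (_ : (fun _ => _) = fun t => tnth t i); first exact: measurable_tnth.
by apply/funext => t; rewrite mxE.
Qed.

Lemma col_of_tuple_cons (R : realType) (n : nat) (x : R)
    (t : n.-tuple (measurableTypeR R)) :
  col_of_tuple [the n.+1.-tuple (measurableTypeR R) of x :: t] =
  col_mx (x%:M : 'cV_1) (col_of_tuple t) :> 'cV[R]_(1 + n).
Proof.
apply/matrixP => i j; rewrite ord1 !mxE.
case: splitP => k.
  by rewrite ord1 => /= i0; rewrite !mxE (_ : i = ord0) //=; exact: val_inj.
by move=> ik; rewrite mxE (_ : i = lift ord0 k) ?tnthS//; apply: val_inj.
Qed.

(** Cavalieri's principle, by unfolding the product measure; the inductions that compute volumes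
    rest on it. *)
Lemma volumeS (R : realType) (n : nat) (K : set 'cV[R]_(1 + n)) :
  volume K = (\int[lebesgue_measure]_x
    volume [set v | K (col_mx (x%:M : 'cV_1) v)])%E.
Proof.
rewrite {1}/volume /= /pushforward /product_measure1.
apply: eq_integral => x _ /=; congr lebesgue_tuple.
apply/seteqP; split => t; rewrite /xsection /= ?inE /= -/(col_of_tuple _);
  by rewrite -/(col_of_tuple t) -col_of_tuple_cons.
Qed.

(** * Sigma-finiteness of the product measure on tuples *)

(** The preimages under the left inverse [g] of a sigma-finite cover of [T1] cover [T2], and [f]
    pulls them back to the original sets. *)
Lemma pushforward_sigma_finite d1 d2 (T1 : measurableType d1)
    (T2 : measurableType d2) (R : realType)
    (mu : {measure set T1 -> \bar R}) (f : T1 -> T2) (g : T2 -> T1) :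
  sigma_finite setT mu ->
  measurable_fun setT f -> measurable_fun setT g -> cancel f g ->
  exists nu : {sigma_finite_measure set T2 -> \bar R}, pushforward mu f = nu.
Proof.
move=> [G GT Gf] mf mg fK.
pose nu : {measure set T2 -> \bar R} :=
  measure_function_pushforward__canonical__measure_function_Measure mu mf.
have snu : sigma_finite setT nu.
  exists (fun k => g @^-1` G k).
    by rewrite -preimage_bigcup -GT preimage_setT.
  move=> k; split.
    by rewrite -[X in measurable X]setTI; apply: mg => //; have [] := Gf k.
  rewrite /nu /= /pushforward /=.
  rewrite (_ : _ @^-1` _ = G k); first by have [] := Gf k.
  by apply/seteqP; split => p /=; rewrite fK.
pose sm := Measure_isSigmaFinite.Build _ _ _ nu snu.
pose nus : {sigma_finite_measure set T2 -> \bar R} :=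
  HB.pack (Measure.sort nu) (Measure.class nu) sm.
by exists nus.
Qed.

(** For increasing exhaustions [F] and [G] the diagonal rectangles, with the same index on both
    sides, already cover the product. *)
Lemma sigma_finite_product d1 d2 (T1 : measurableType d1)
    (T2 : measurableType d2) (R : realType)
    (m1 : {sigma_finite_measure set T1 -> \bar R})
    (m2 : {sigma_finite_measure set T2 -> \bar R}) :
  sigma_finite setT (m1 \x m2)%E.
Proof.
have /sigma_finiteP[F [TF ndF Foo]] := sigma_finiteT m1.
have /sigma_finiteP[G [TG ndG Goo]] := sigma_finiteT m2.
exists (fun n => F n `*` G n).
  apply/esym/seteqP; split => // -[x y] _.
  have [n _ Fx] : (\bigcup_i F i) x by rewrite -TF.
  have [k _ Gy] : (\bigcup_i G i) y by rewrite -TG.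
  exists (maxn n k) => //; split => /=.
    by move: x Fx; exact/subsetPset/ndF/leq_maxl.
  by move: y Gy; exact/subsetPset/ndG/leq_maxr.
move=> k; have [mF Fk] := Foo k; have [mG Gk] := Goo k.
split; first exact: measurableX.
by rewrite product_measure1E// lte_mul_pinfty// ge0_fin_numE.
Qed.

(** The recursion defining [lebesgue_tuple] yields a bare set function; this gives access to the
    theorems on sigma-finite measures, such as the measurability of section volumes. *)
Lemma lebesgue_tuple_measure (R : realType) (n : nat) :
  exists mu : {sigma_finite_measure set (n.-tuple (measurableTypeR R)) -> \bar R},
    @lebesgue_tuple R n = mu.
Proof.
elim: n => [|n [mu /= muE]].
  by exists (\d_[tuple] : {sigma_finite_measure set _ -> \bar R}).
rewrite /= muE.
apply: (pushforward_sigma_finite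
  (g := fun t => (thead t, [tuple of behead t]))).
- exact: (@sigma_finite_product _ _ _ _ _ (@lebesgue_measure R) mu).
- exact: measurable_cons.
- apply/measurable_fun_pair => /=; first exact: measurable_tnth.
  exact: measurable_behead.
- by case=> x t /=; congr (_, _); apply/val_inj.
Qed.

(** * Measurable vector-valued maps and measurability of slice volumes *)

Definition measurable_vec (R : realType) d (T : measurableType d) (n : nat)
    (f : T -> 'cV[R]_n) : Prop :=
  forall i, measurable_fun setT (fun x => f x i 0 : measurableTypeR R).

Lemma measurable_vec_tuple (R : realType) (n : nat) :
  measurable_vec (@col_of_tuple R n).
Proof. exact: measurable_coord. Qed.

Lemma measurable_vec_cst (R : realType) d (T : measurableType d) (n : nat)
    (c : 'cV[R]_n) : measurable_vec (fun _ : T => c).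
Proof. by move=> i; exact: measurable_cst. Qed.

Lemma measurable_vec_comp (R : realType) d (T : measurableType d)
    d' (T' : measurableType d') (n : nat) (f : T -> 'cV[R]_n) (h : T' -> T) :
  measurable_fun setT h -> measurable_vec f -> measurable_vec (f \o h).
Proof. by move=> mh mf i; exact: (measurableT_comp (mf i) mh). Qed.

Lemma measurable_vecD (R : realType) d (T : measurableType d) (n : nat)
    (f g : T -> 'cV[R]_n) :
  measurable_vec f -> measurable_vec g -> measurable_vec (fun x => f x + g x).
Proof.
move=> mf mg i; under eq_fun do rewrite mxE.
exact: (measurable_funD (mf i) (mg i)).
Qed.

Lemma measurable_vec_mulmx (R : realType) d (T : measurableType d) (m n : nat)
    (M : 'M[R]_(m, n)) (f : T -> 'cV[R]_n) :
  measurable_vec f -> measurable_vec (fun x => M *m f x).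
Proof.
move=> mf i; under eq_fun do rewrite mxE.
apply: (@measurable_sum _ _ _ _ _ _ (fun j x => M i j * f x j 0)) => j.
by apply: measurable_funM; [exact: measurable_cst|exact: mf].
Qed.

Lemma measurable_vec_scalar (R : realType) d (T : measurableType d)
    (f : T -> measurableTypeR R) :
  measurable_fun setT f -> measurable_vec (fun x => (f x)%:M : 'cV[R]_1).
Proof. by move=> mf i; under eq_fun do rewrite ord1 mxE. Qed.

Lemma measurable_vec_col_mx (R : realType) d (T : measurableType d) (m n : nat)
    (f : T -> 'cV[R]_m) (g : T -> 'cV[R]_n) :
  measurable_vec f -> measurable_vec g ->
  measurable_vec (fun x => col_mx (f x) (g x)).
Proof.
move=> mf mg i; rewrite -(fintype.splitK i).
case: (fintype.split i) => j /=.
  by under eq_fun do rewrite col_mxEu; exact: mf.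
by under eq_fun do rewrite col_mxEd; exact: mg.
Qed.

Lemma measurable_col_mulmx (R : realType) (m n : nat) (M : 'M[R]_(m, n))
    (K : set 'cV[R]_m) :
  measurable_col K -> measurable_col [set v | K (M *m v)].
Proof.
move=> mK; apply: (@measurable_col_preimage _ _ _ _
  (fun t => M *m @col_of_tuple R n t)) => //.
by apply: measurable_vec_mulmx; exact: measurable_vec_tuple.
Qed.

Lemma measurable_col_translate (R : realType) (n : nat) (c : 'cV[R]_n)
    (K : set 'cV[R]_n) :
  measurable_col K -> measurable_col [set v | K (v + c)].
Proof.
move=> mK; apply: (@measurable_col_preimage _ _ _ _
  (fun t => @col_of_tuple R n t + c)) => //.
apply: measurable_vecD; [exact: measurable_vec_tuple|exact: measurable_vec_cst].
Qed.

Lemma measurable_col_section (R : realType) (n : nat) (x : R)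
    (K : set 'cV[R]_(1 + n)) :
  measurable_col K -> measurable_col [set v | K (col_mx (x%:M : 'cV_1) v)].
Proof.
move=> mK; apply: (@measurable_col_preimage _ _ _ _
  (fun t => col_mx (x%:M : 'cV_1) (@col_of_tuple R n t))) => //.
apply: measurable_vec_col_mx; last exact: measurable_vec_tuple.
exact: measurable_vec_cst.
Qed.

(** The pairs that [g] sends into [K] form a measurable subset of the product, and the measures of
    its sections depend measurably on [x]. *)
Lemma measurable_volume (R : realType) d (T : measurableType d) (m n : nat)
    (g : T -> 'cV[R]_n -> 'cV[R]_m) (K : set 'cV[R]_m) :
  measurable_vec (fun z : T * n.-tuple (measurableTypeR R) =>
    g z.1 (col_of_tuple z.2)) ->
  measurable_col K ->
  measurable_fun setT (fun x => volume [set v | K (g x v)]).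
Proof.
move=> mg mK; have [mu muE] := lebesgue_tuple_measure R n.
have := measurable_fun_xsection mu (measurable_col_preimage mg mK).
congr (measurable_fun _ _); apply/funext => x /=.
rewrite /volume muE; congr (mu _).
by apply/seteqP; split => t; rewrite /xsection /= inE.
Qed.

Lemma volume_ge0 (R : realType) (n : nat) (K : set 'cV[R]_n) :
  (0 <= volume K)%E.
Proof. by have [mu muE] := lebesgue_tuple_measure R n; rewrite /volume muE. Qed.

Lemma le_volume (R : realType) (n : nat) (K L : set 'cV[R]_n) :
  measurable_col K -> measurable_col L -> K `<=` L -> (volume K <= volume L)%E.
Proof.
move=> mK mL KL; have [mu muE] := lebesgue_tuple_measure R n.
by rewrite !volumeE muE; apply: le_measure; rewrite ?inE// => t /KL.
Qed.

Lemma measurable_section_volume (R : realType) (n : nat)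
    (K : set 'cV[R]_(1 + n)) :
  measurable_col K -> measurable_fun setT (fun x : measurableTypeR R =>
    volume [set v | K (col_mx (x%:M : 'cV_1) v)]).
Proof.
move=> mK; apply: (@measurable_volume R _ (measurableTypeR R) (1 + n) n
  (fun x v => col_mx (x%:M : 'cV_1) v) K _ mK).
apply: measurable_vec_col_mx.
  by apply: measurable_vec_scalar; exact: measurable_fst.
exact: (measurable_vec_comp _ (@measurable_vec_tuple R n)).
Qed.

(** * Translations, block triangular maps and the exchange of coordinates *)

(** Lebesgue measure is determined by its values on half-open intervals, and there the scaled image
    measure is computed directly. *)
Lemma lebesgue_measure_affine (R : realType) (a b : R) (X : set R) :
  a != 0 -> measurable (X : set (measurableTypeR R)) ->
  lebesgue_measure X =
  (`|a|%:E * lebesgue_measure ((fun x => a * x + b)%R @^-1` X))%E.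
Proof.
move=> a0 mX.
have mf : measurable_fun setT
    (fun x : measurableTypeR R => a * x + b : measurableTypeR R).
  apply: measurable_funD; last exact: measurable_cst.
  by apply: measurable_funM => //; exact: measurable_cst.
pose nu : {measure set (measurableTypeR R) -> \bar R} :=
  measure_function_pushforward__canonical__measure_function_Measure
    (@lebesgue_measure R) mf.
pose sc : {measure set (measurableTypeR R) -> \bar R} :=
  mscale (NngNum (normr_ge0 a)) nu.
apply: (@lebesgue_measure_unique R sc) => // _ [[u v] _ <-] /=.
rewrite /sc /nu /mscale /= /pushforward.
have [a_gt0|a_lt0|/eqP] := ltgtP 0 a; last by rewrite eq_sym (negbTE a0).
  rewrite (_ : _ @^-1` _ = `](u - b) / a, (v - b) / a]%classic); last first.
    apply/seteqP; split => x /=; rewrite !in_itv /=;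
      by rewrite ltr_pdivrMr// ler_pdivlMr// ltrBlDr lerBrDr mulrC.
  rewrite !lebesgue_measure_itv /= !lte_fin ltr_pM2r ?invr_gt0// ltrD2r.
  case: ifP => // _; last by rewrite mule0.
  rewrite -!EFinD -EFinM gtr0_norm//; congr EFin.
  by field.
(* A negative factor reverses the interval: the closed end is now on the left, which does not affect
   the measure. *)
rewrite (_ : _ @^-1` _ = `[(v - b) / a, (u - b) / a[%classic); last first.
  apply/seteqP; split => x /=; rewrite !in_itv /=;
    by rewrite ltr_ndivlMr// ler_ndivrMr// ltrBlDr lerBrDr mulrC andbC.
rewrite !lebesgue_measure_itv /= !lte_fin ltr_nM2r ?invr_lt0// ltrD2r.
case: ifP => // _; last by rewrite mule0.
rewrite -!EFinD -EFinM ltr0_norm//; congr EFin.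
by field.
Qed.

Lemma integral_lebesgue_affine (R : realType) (a b : R)
    (f : measurableTypeR R -> \bar R) :
  a != 0 -> measurable_fun setT f -> (forall x, 0 <= f x)%E ->
  (\int[lebesgue_measure]_x f x =
   `|a|%:E * \int[lebesgue_measure]_x f (a * x + b)%R)%E.
Proof.
move=> a0 mf f0.
have mg : measurable_fun setT
    (fun x : measurableTypeR R => a * x + b : measurableTypeR R).
  apply: measurable_funD; last exact: measurable_cst.
  by apply: measurable_funM => //; exact: measurable_cst.
pose nu : {measure set (measurableTypeR R) -> \bar R} :=
  measure_function_pushforward__canonical__measure_function_Measure
    (@lebesgue_measure R) mg.
rewrite (@eq_measure_integral _ _ _ _ (mscale (NngNum (normr_ge0 a)) nu)).
  rewrite ge0_integral_mscale//; congr (_ * _)%E.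
  by rewrite ge0_integral_pushforward.
by move=> X mX _; exact: (lebesgue_measure_affine b a0 mX).
Qed.

(** By induction on slices: the first coordinate of [c] shifts the integration variable, the others
    translate the slice. *)
Lemma volume_translate (R : realType) (n : nat) (c : 'cV[R]_n)
    (K : set 'cV[R]_n) :
  measurable_col K -> volume [set v | K (v + c)] = volume K.
Proof.
elim: n c K => [|n IH] c K mK.
  congr volume; apply/seteqP; split => v /=; by rewrite [v + c]flatmx0 [v]flatmx0.
rewrite -[c](@vsubmxK _ 1 n) [usubmx _]mx11_scalar; set a := usubmx _ 0 0.
set c' := dsubmx _.
rewrite (@volumeS _ _ [set v | K (v + col_mx a%:M c')]) (@volumeS _ _ K).
rewrite [RHS](@integral_lebesgue_affine _ 1 a); first last.
- by move=> x; exact: volume_ge0.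
- exact: measurable_section_volume.
- exact: oner_neq0.
rewrite normr1 mul1e; apply: eq_integral => x _ /=.
rewrite -[RHS](IH c'); last exact: measurable_col_section.
congr volume; apply/seteqP; split => v /=;
  by rewrite add_col_mx -raddfD mul1r.
Qed.

(** Substituting [a * x] in the slice integral produces [|a|]; on each slice there remains [L]
    followed by the translation by [c *m x%:M], which contributes [|det L|]. *)
Lemma volume_block_lower (R : realType) (n : nat) (a : R) (c : 'cV[R]_n)
    (L : 'M[R]_n) (K : set 'cV[R]_(1 + n)) :
  (forall H : set 'cV[R]_n, measurable_col H ->
    ((`|\det L|%R)%:E * volume [set v | H (L *m v)] = volume H)%E) ->
  a != 0 -> measurable_col K ->
  ((`|\det (block_mx (a%:M : 'M[R]_1) 0 c L)|%R)%:E *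
    volume [set v | K (block_mx (a%:M : 'M[R]_1) 0 c L *m v)] = volume K)%E.
Proof.
move=> IH a0 mK; have mK' := measurable_section_volume mK.
rewrite det_lblock det_scalar1 normrM EFinM -muleA.
rewrite (@volumeS _ _ [set v | K (_ *m v)]) (@volumeS _ _ K).
rewrite [RHS](@integral_lebesgue_affine _ a 0) //; last first.
  by move=> x; exact: volume_ge0.
congr (_ * _)%E; rewrite -ge0_integralZl//; last 2 first.
- apply: (@measurable_volume _ _ (measurableTypeR R) _ _ (fun x v =>
    block_mx (a%:M : 'M[R]_1) 0 c L *m col_mx (x%:M : 'cV_1) v)) => //.
  apply: measurable_vec_mulmx; apply: measurable_vec_col_mx.
    by apply: measurable_vec_scalar; exact: measurable_fst.
  exact: (measurable_vec_comp _ (@measurable_vec_tuple R n)).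
- by move=> x _; exact: volume_ge0.
apply: eq_integral => x _; rewrite addr0.
rewrite -[RHS](@volume_translate _ _ (c *m x%:M)); last exact: measurable_col_section.
rewrite -[RHS]IH; last first.
  by apply: measurable_col_translate; exact: measurable_col_section.
congr (_ * volume _)%E; apply/seteqP; split => v /=;
  by rewrite mul_block_col mul0mx addr0 -scalar_mxM addrC.
Qed.

Lemma lebesgue_tonelli (R : realType) (F : R -> R -> \bar R) :
  measurable_fun setT
    (fun p : measurableTypeR R * measurableTypeR R => F p.1 p.2) ->
  (forall x y, 0 <= F x y)%E ->
  (\int[lebesgue_measure]_x \int[lebesgue_measure]_y F x y =
   \int[lebesgue_measure]_y \int[lebesgue_measure]_x F x y)%E.
Proof.
move=> mF F0; exact: (@fubini_tonelli _ _ _ _ R (@lebesgue_measure R)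
  (@lebesgue_measure R) (fun p => F p.1 p.2) mF (fun p => F0 p.1 p.2)).
Qed.

(** Slicing twice turns the exchange of coordinates into an exchange of integrals, which is
    Tonelli's theorem. *)
Lemma volume_swap (R : realType) (n : nat) (K : set 'cV[R]_(1 + (1 + n))) :
  measurable_col K ->
  volume [set v | K (xrow 0 1 v)] = volume K.
Proof.
move=> mK.
have xrowE (x y : R) (w : 'cV[R]_n) :
    xrow 0 1 (col_mx (x%:M : 'cV_1) (col_mx (y%:M : 'cV_1) w)) =
    col_mx (y%:M : 'cV_1) (col_mx (x%:M : 'cV_1) w) :> 'cV_(1 + (1 + n)).
  have e0 : 0 = lshift (1 + n) 0 :> 'I_(1 + (1 + n)) by exact/val_inj.
  have e1 : 1 = rshift 1 (lshift n 0) :> 'I_(1 + (1 + n)) by exact/val_inj.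
  apply/matrixP => i j; rewrite ord1 mxE {j}; case: (fintype.split_ordP i) => [k|k] ->.
    rewrite [k]ord1 -e0 tpermL e0 e1.
    apply: etrans (etrans (col_mxEd _ _ _ _) (col_mxEu _ _ _ _)) _.
    by rewrite col_mxEu !mxE.
  case: (fintype.split_ordP k) => [l|l] ->.
    rewrite [l]ord1 -e1 tpermR e0 e1.
    apply: etrans (col_mxEu _ _ _ _) _; apply: esym.
    apply: etrans (etrans (col_mxEd _ _ _ _) (col_mxEu _ _ _ _)) _.
    by rewrite !mxE.
  rewrite tpermD ?e0 ?e1 ?eq_lrshift ?(inj_eq rshift_inj) ?eq_lrshift //.
  exact: etrans (etrans (col_mxEd _ _ _ _) (col_mxEd _ _ _ _))
    (esym (etrans (col_mxEd _ _ _ _) (col_mxEd _ _ _ _))).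
pose F (x y : R) := volume [set w : 'cV[R]_n |
  K (col_mx (x%:M : 'cV_1) (col_mx (y%:M : 'cV_1) w))].
have volE : volume K = (\int[lebesgue_measure]_x \int[lebesgue_measure]_y F x y)%E.
  by rewrite volumeS; apply: eq_integral => x _; rewrite volumeS.
have -> : volume [set v | K (xrow 0 1 v)] =
    (\int[lebesgue_measure]_x \int[lebesgue_measure]_y F y x)%E.
  rewrite volumeS; apply: eq_integral => x _; rewrite volumeS.
  apply: eq_integral => y _; congr volume.
  by apply/seteqP; split => w /=; rewrite xrowE.
rewrite volE.
have mF : measurable_fun setT
    (fun p : measurableTypeR R * measurableTypeR R => F p.1 p.2).
  apply: (@measurable_volume R _ (measurableTypeR R * measurableTypeR R)%type
    _ n (fun p w => col_mx (p.1%:M : 'cV_1) (col_mx (p.2%:M : 'cV_1) w)) K _ mK).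
  apply: measurable_vec_col_mx.
    apply: measurable_vec_scalar.
    by apply: (measurableT_comp measurable_fst measurable_fst).
  apply: measurable_vec_col_mx.
    apply: measurable_vec_scalar.
    by apply: (measurableT_comp measurable_snd measurable_fst).
  exact: (measurable_vec_comp _ (@measurable_vec_tuple R n)).
by apply/esym/lebesgue_tonelli => // x y; exact: volume_ge0.
Qed.

(** * Volume of linear images *)

(** Since [b] has rank one, its rank factorization exhibits it as a nonzero scalar times the first
    row of the invertible matrix [row_ebase b]. *)
Lemma unitmx_first_row (F : fieldType) (n : nat) (b : 'rV[F]_n.+1) :
  b != 0 -> exists2 L : 'M[F]_n.+1, L \in unitmx & row 0 L = b.
Proof.
move=> b0; pose c := col_ebase b 0 0.
have c0 : c != 0.
  have := col_ebase_unit b.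
  by rewrite [col_ebase b]mx11_scalar unitmxE det_scalar1 unitfE.
exists (c *: row_ebase b).
  by rewrite unitmxZ ?unitfE// row_ebase_unit.
rewrite -[RHS]mulmx_ebase [col_ebase b]mx11_scalar -/c mul_scalar_mx.
rewrite rank_rV b0 /= -scalemxAl; apply/rowP => j; rewrite !mxE; congr (_ * _).
rewrite (bigD1 0)//= big1 ?addr0 => [|i i0]; first by rewrite mxE mul1r.
by rewrite mxE; case: i i0 => -[|i] //= ? _; rewrite mul0r.
Qed.

(** Preimages instead of images keep the formula free of inverses and make the property pass
    directly to products. *)
Definition scales_volume (R : realType) (n : nat) (M : 'M[R]_n) : Prop :=
  forall K : set 'cV[R]_n, measurable_col K ->
  ((`|\det M|%R)%:E * volume [set v | K (M *m v)] = volume K)%E.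

Lemma scales_volumeM (R : realType) (n : nat) (M N : 'M[R]_n) :
  scales_volume M -> scales_volume N -> scales_volume (M *m N).
Proof.
move=> sM sN K mK; rewrite det_mulmx normrM EFinM -muleA -[RHS]sM//.
rewrite -(sN [set v | K (M *m v)]); last exact: measurable_col_mulmx.
by congr (_ * (_ * volume _))%E; apply/seteqP; split => v /=; rewrite mulmxA.
Qed.

Lemma scales_volume_swap (R : realType) (n : nat) :
  scales_volume (tperm_mx 0 1 : 'M[R]_(1 + (1 + n))).
Proof.
move=> K mK; rewrite det_perm odd_tperm /= expr1 normrN1 mul1e.
rewrite -(volume_swap mK); congr (volume _).
by apply/seteqP; split => v /=; rewrite xrowE.
Qed.

(* Bruhat decomposition with respect to the parabolic P of matrices whose first
   row is a multiple of e_0: a matrix M outside P is a product X s N where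
   s exchanges the first two coordinates, and N in P is chosen so that s N has
   the same first row as M, whence X has first row e_0. *)
Lemma unitmx_scales_volume (R : realType) (n : nat) (M : 'M[R]_n) :
  M \in unitmx -> scales_volume M.
Proof.
elim: n M => [|n IH] M uM.
  move=> K _; rewrite det_mx00 normr1 mul1e; congr volume.
  by apply/seteqP; split => v /=; rewrite [v]flatmx0 [_ *m _]flatmx0.
have lowerP (N : 'M[R]_(1 + n)) :
    N \in unitmx -> ursubmx N = 0 -> scales_volume N.
  rewrite unitmxE unitfE -[N]submxK => + ur; rewrite block_mxKur in ur.
  rewrite {}ur [ulsubmx N]mx11_scalar det_lblock det_scalar1 mulf_eq0 negb_or.
  move=> /andP[a0 L0] H mH; apply: volume_block_lower => // H' mH'.
  by apply: IH => //; rewrite unitmxE unitfE.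
change 'M[R]_(1 + n) in M.
have [/lowerP|b0] := eqVneq (ursubmx M) 0; first exact.
(* A nonzero upper right block forces at least two coordinates, so there is a second one to exchange
   with the first. *)
clear IH; case: n M b0 uM lowerP => [|n] M b0 uM lowerP.
  by rewrite [ursubmx M]thinmx0 eqxx in b0.
have [L uL L0] := unitmx_first_row b0.
(* Each lower row of [N] starts with the corner entry of [M], and the first row of [L] is the rest
   of the first row of [M]; [s] brings this row to the top. *)
pose N : 'M[R]_(1 + n.+1) := block_mx 1%:M 0 (const_mx (ulsubmx M 0 0)) L.
have uN : N \in unitmx.
  by rewrite unitmxE det_lblock det1 mul1r -unitmxE.
pose s : 'M[R]_(1 + n.+1) := tperm_mx 0 1.
have us : s \in unitmx by exact: unitmx_perm.
have usN : s *m N \in unitmx by rewrite unitmx_mul us.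
rewrite -[M](mulmxKV usN); apply: scales_volumeM; last first.
  apply: scales_volumeM; first exact: scales_volume_swap.
  by apply: lowerP => //; rewrite block_mxKur.
apply: lowerP; first by rewrite unitmx_mul uM unitmx_inv.
have e0 : 0 = lshift n.+1 0 :> 'I_(1 + n.+1) by exact: val_inj.
have rowsN : row 0 (s *m N) = row 0 M.
  have e1 : fintype.split (1 : 'I_(1 + n.+1)) = inr 0.
    by rewrite -[RHS]unsplitK; congr fintype.split; exact: val_inj.
  apply/rowP => j; rewrite -xrowE mxE mxE mxE tpermL e1.
  rewrite -(fintype.splitK j); case: (fintype.split j) => k /=.
    by rewrite row_mxEl [k]ord1 !mxE e0.
  by have := congr1 (fun r : 'rV[R]_n.+1 => r 0 k) L0; rewrite row_mxEr !mxE e0.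
apply/matrixP => i j; rewrite [i]ord1.
have := congr1 (fun r : 'rV[R]_(1 + n.+1) => (r *m invmx (s *m N)) 0 (rshift 1 j)) rowsN.
rewrite /= -!row_mul mulmxV// => /esym.
rewrite [LHS]mxE [RHS]mxE [RHS]mxE => XE.
by rewrite [LHS]mxE [LHS]mxE -[lshift _ _]e0 XE [RHS]mxE e0.
Qed.

Lemma linear_image_unitE (R : realType) (n : nat) (A : 'M[R]_n)
    (K : set 'cV[R]_n) :
  A \in unitmx -> linear_image A K = [set v | K (invmx A *m v)].
Proof.
move=> uA; apply/seteqP; split => [_ [x Kx <-]|v Kv] /=.
  by rewrite mulKmx.
by exists (invmx A *m v); rewrite ?mulKVmx.
Qed.

Lemma linear_imageM (R : realType) (n : nat) (A B : 'M[R]_n)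
    (K : set 'cV[R]_n) :
  linear_image A (linear_image B K) = linear_image (A *m B) K.
Proof.
apply/seteqP; split => [_ [_ [x Kx <-] <-]|_ [x Kx <-]].
  by exists x; rewrite ?mulmxA.
by exists (B *m x); [exists x|rewrite mulmxA].
Qed.

Lemma volume_linear_image (R : realType) (n : nat) (A : 'M[R]_n)
    (K : set 'cV[R]_n) :
  A \in unitmx -> measurable_col K ->
  volume (linear_image A K) = ((`|\det A|%R)%:E * volume K)%E.
Proof.
move=> uA mK; rewrite linear_image_unitE//.
have uA' : invmx A \in unitmx by rewrite unitmx_inv.
rewrite -(unitmx_scales_volume uA' mK) muleA -EFinM -normrM -det_mulmx.
by rewrite mulmxV// det1 normr1 mul1e.
Qed.

(** * Boxes, measurability of compact sets and bounds on volumes *)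

(** For positive [r] this is the open ball of the sup norm, written coordinatewise as a product of
    intervals. *)
Definition box (R : realType) (n : nat) (c : 'cV[R]_n) (r : R) : set 'cV[R]_n :=
  [set v | forall i, `|c i 0 - v i 0| < r].

Lemma measurable_box (R : realType) (n : nat) (c : 'cV[R]_n) (r : R) :
  measurable_col (box c r).
Proof.
rewrite /measurable_col (_ : _ @^-1` _ = \bigcap_(i in [set: 'I_n])
    ((fun t => @col_of_tuple R n t i 0) @^-1` (ball (c i 0) r : set R))).
  apply: fin_bigcap_measurable => // i _; rewrite -[X in measurable X]setTI.
  by apply: (@measurable_coord R n i) => //; exact: measurable_ball.
by apply/seteqP; split => t /= H i; [move=> _|]; exact: H.
Qed.

Lemma ball_box (R : realType) (n : nat) (c : 'cV[R]_n) (r : R) :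
  0 < r -> ball c r = box c r.
Proof.
move=> r0; apply/seteqP; split => [v [_ cv] i|v cv]; first exact: cv.
by split=> // i j; rewrite ord1; exact: cv.
Qed.

(** There are countably many boxes with rational centre and radius, and an open set is the union of
    those that it contains. *)
Lemma measurable_col_open (R : realType) (n : nat) (U : set 'cV[R]_n) :
  open U -> measurable_col U.
Proof.
move=> oU.
pose B (p : 'cV[rat]_n * rat) : set 'cV[R]_n := box (map_mx ratr p.1) (ratr p.2).
(* Codes of no box, or of a box not contained in [U], contribute the empty set. *)
pose F k := if unpickle k is Some p then if `[< B p `<=` U >] then B p else set0
  else set0.
have -> : U = \bigcup_k F k.
  apply/seteqP; split => [v Uv|v [k _]]; last first.
    rewrite /F; case: unpickle => // p; case: asboolP => //; exact.
  have [e /= e0 eU] : nbhs_ball v U by apply/nbhs_ballP; exact: open_nbhs_nbhs.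
  (* A radius below [e / 2] suffices: a box of radius [r] whose centre is within [r] of [v] stays in
     the ball of radius [e] around [v]. *)
  have [r] := @rat_in_itvoo R 0 (e / 2) (divr_gt0 e0 (ltr0Sn _ 1)).
  rewrite in_itv /= => /andP[r0 re].
  have q_ex i : exists q : rat, `|ratr q - v i 0| < ratr r.
    have [|q] := @rat_in_itvoo R (v i 0 - ratr r) (v i 0 + ratr r).
      by rewrite ltrD2l gtrN.
    by rewrite in_itv /= => qv; exists q; rewrite ltr_distl.
  pose q : 'cV[rat]_n := \col_i projT1 (cid (q_ex i)).
  have Bqv : B (q, r) v.
    by move=> i /=; rewrite !mxE; exact: projT2 (cid (q_ex i)).
  exists (pickle (q, r)) => //; rewrite /F pickleK asboolT // => w Bqw.
  apply: eU; rewrite ball_box// => i.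
  have -> : v i 0 - w i 0 = (ratr (q i 0) - w i 0) - (ratr (q i 0) - v i 0).
    by ring.
  rewrite (le_lt_trans (ler_normB _ _))// (splitr e) ltrD//.
    by rewrite (lt_trans _ re)//; have := Bqw i; rewrite mxE.
  by rewrite (lt_trans _ re)//; have := Bqv i; rewrite mxE.
rewrite /measurable_col preimage_bigcup; apply: bigcupT_measurable => k.
rewrite /F; case: unpickle => [p|]; last by rewrite preimage_set0.
by case: asboolP => _; [exact: measurable_box|rewrite preimage_set0].
Qed.

Lemma measurable_col_compact (R : realType) (n : nat) (K : set 'cV[R]_n) :
  compact K -> measurable_col K.
Proof.
move=> cK; have oK : open (~` K).
  by apply: closed_openC; apply: compact_closed => //; exact: norm_hausdorff.
have := measurableC (measurable_col_open oK).
by rewrite -preimage_setC setCK.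
Qed.

Lemma box_col_mx (R : realType) (n : nat) (a x r : R) (c v : 'cV[R]_n) :
  box (col_mx (a%:M : 'cV_1) c) r (col_mx (x%:M : 'cV_1) v) <->
  `|a - x| < r /\ box c r v.
Proof.
split=> [H|[ax cv] i].
  split=> [|i]; last by have := H (rshift 1 i); rewrite !col_mxEd.
  by have := H (lshift n 0); rewrite !col_mxEu !mxE.
rewrite -(fintype.splitK i); case: (fintype.split i) => j /=.
  by rewrite !col_mxEu ord1 !mxE.
by rewrite !col_mxEd; exact: cv.
Qed.

(** The slice at [x] is a box of one dimension less if [x] is within [r] of the first coordinate of
    [c], and empty otherwise. *)
Lemma volume_box (R : realType) (n : nat) (c : 'cV[R]_n) (r : R) :
  0 < r -> volume (box c r) = ((r *+ 2) ^+ n)%:E.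
Proof.
move=> r0; elim: n c => [|n IH] c.
  by rewrite expr0 /volume /= diracE mem_set//= => -[].
rewrite -[c](@vsubmxK _ 1 n) [usubmx _]mx11_scalar; set a := usubmx _ 0 0.
set c' := dsubmx _; rewrite volumeS.
pose X : set (measurableTypeR R) := (ball a r : set R).
have mX : measurable X by exact: measurable_ball.
rewrite (eq_integral (fun x : measurableTypeR R =>
    ((r *+ 2) ^+ n)%:E * (\1_X x)%:E)%E).
  rewrite ge0_integralZl//; last 2 first.
  - apply: measurableT_comp => //; exact: measurable_indic.
  - by rewrite lee_fin exprn_ge0// mulrn_wge0// ltW.
  rewrite integral_indic ?setIT//.
  transitivity (((r *+ 2) ^+ n)%:E * (r *+ 2)%:E)%E.
    by congr (_ * _)%E; exact: (lebesgue_measure_ball a (ltW r0)).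
  by rewrite -EFinM exprSr.
move=> x _; rewrite indicE.
have [/set_mem ax|ax] := boolP (x \in X).
  rewrite mule1 -(IH c'); congr volume; apply/seteqP; split => v /=.
    by move=> /box_col_mx[].
  by move=> cv; apply/box_col_mx.
rewrite mule0 (_ : [set v | _] = set0).
  rewrite volumeE preimage_set0; have [mu ->] := lebesgue_tuple_measure R n.
  by rewrite measure0.
apply/seteqP; split => // v /= /box_col_mx[].
by move: ax; rewrite notin_setE.
Qed.

(** The set contains a box and is contained in another one, which bounds its volume away from zero
    and infinity. *)
Lemma volume_compact_interior (R : realType) (n : nat) (K : set 'cV[R]_n) :
  compact K -> K° !=set0 ->
  exists2 v : R, 0 < v & volume K = v%:E.
Proof.
move=> cK [c /nbhs_ballP[r /= r0 rK]].
have mK := measurable_col_compact cK.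
have lb : (((r *+ 2) ^+ n)%:E <= volume K)%E.
  rewrite -(volume_box c r0); apply: le_volume => //; first exact: measurable_box.
  by rewrite -ball_box.
have [M [_ HM]] := compact_bounded cK.
have {}HM : forall x, K x -> `|x| <= `|M| + 1.
  by apply: HM; rewrite (le_lt_trans (ler_norm _))// ltrDl.
(* Boxes are open, hence a radius strictly larger than the bound [|M| + 1]. *)
have ub : (volume K <= (((`|M| + 2) *+ 2) ^+ n)%:E)%E.
  rewrite -(volume_box 0); last by rewrite addrC ltr_pwDl.
  apply: le_volume => //; first exact: measurable_box.
  move=> v /HM vM; rewrite -ball_box; last by rewrite addrC ltr_pwDl.
  rewrite -ball_normE /= sub0r normrN (le_lt_trans vM)// ltrD2l.
  by rewrite ltr1n.
have fv : volume K \is a fin_num.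
  by rewrite ge0_fin_numE ?volume_ge0// (le_lt_trans ub)// ltry.
exists (fine (volume K)); last by rewrite fineK.
rewrite -lte_fin fineK//; apply: lt_le_trans lb.
by rewrite lte_fin exprn_gt0// mulrn_wgt0.
Qed.

(** * The Euclidean norm *)

Lemma euclid_norm_ge0 (R : realType) (n : nat) (v : 'cV[R]_n) :
  0 <= euclid_norm v.
Proof. exact: sqrtr_ge0. Qed.

Lemma sqr_euclid_norm (R : realType) (n : nat) (v : 'cV[R]_n) :
  euclid_norm v ^+ 2 = (v^T *m v) 0 0.
Proof.
rewrite sqr_sqrtr; last by apply: sumr_ge0 => i _; exact: sqr_ge0.
by rewrite mxE; apply: eq_bigr => i _; rewrite mxE -expr2.
Qed.

Lemma euclid_norm_eq0 (R : realType) (n : nat) (v : 'cV[R]_n) :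
  (euclid_norm v == 0) = (v == 0).
Proof.
have s0 i : true -> 0 <= v i 0 ^+ 2 by rewrite sqr_ge0.
rewrite sqrtr_eq0 le_eqVlt ltNge sumr_ge0// orbF psumr_eq0//.
apply/allP/eqP => [H|-> i _ /=]; last by rewrite mxE expr0n.
apply/matrixP => i j; rewrite ord1 mxE; apply/eqP.
by rewrite -sqrf_eq0; apply: (implyP (H i (mem_index_enum i))).
Qed.

Lemma euclid_normZ (R : realType) (n : nat) (a : R) (v : 'cV[R]_n) :
  euclid_norm (a *: v) = `|a| * euclid_norm v.
Proof.
rewrite /euclid_norm -sqrtr_sqr -sqrtrM ?sqr_ge0// mulr_sumr.
by congr Num.sqrt; apply: eq_bigr => i _; rewrite mxE exprMn.
Qed.

(** Cauchy-Schwarz: with [a] and [b] the norms of [u] and [v], the sum of the squares of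
    [b * u i 0 - a * v i 0] is [2 * (a * b)] times the difference of the two sides. Zero vectors are
    treated apart because [a * b] is cancelled. *)
Lemma dot_le_euclid_norm (R : realType) (n : nat) (u v : 'cV[R]_n) :
  \sum_i u i 0 * v i 0 <= euclid_norm u * euclid_norm v.
Proof.
have [/eqP|u0] := boolP (euclid_norm u == 0).
  move=> u0; rewrite u0 mul0r; move/eqP: u0; rewrite euclid_norm_eq0 => /eqP ->.
  by rewrite big1// => i _; rewrite mxE mul0r.
have [/eqP|v0] := boolP (euclid_norm v == 0).
  move=> v0; rewrite v0 mulr0; move/eqP: v0; rewrite euclid_norm_eq0 => /eqP ->.
  by rewrite big1// => i _; rewrite mxE mulr0.
have ua : 0 < euclid_norm u by rewrite lt0r u0 euclid_norm_ge0.
have va : 0 < euclid_norm v by rewrite lt0r v0 euclid_norm_ge0.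
have uE : euclid_norm u ^+ 2 = \sum_i u i 0 ^+ 2.
  by rewrite sqr_sqrtr//; apply: sumr_ge0 => i _; exact: sqr_ge0.
have vE : euclid_norm v ^+ 2 = \sum_i v i 0 ^+ 2.
  by rewrite sqr_sqrtr//; apply: sumr_ge0 => i _; exact: sqr_ge0.
set a := euclid_norm u in ua uE *; set b := euclid_norm v in va vE *.
have : 0 <= \sum_i (b * u i 0 - a * v i 0) ^+ 2.
  by apply: sumr_ge0 => i _; exact: sqr_ge0.
have -> : \sum_i (b * u i 0 - a * v i 0) ^+ 2 =
    2 * (a * b) * (a * b - \sum_i u i 0 * v i 0).
  transitivity (b ^+ 2 * (\sum_i u i 0 ^+ 2) + a ^+ 2 * (\sum_i v i 0 ^+ 2) -
      2 * (a * b) * (\sum_i u i 0 * v i 0)); last by rewrite -uE -vE; ring.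
  rewrite !mulr_sumr -big_split -sumrB; apply: eq_bigr => i _ /=; ring.
by rewrite pmulr_rge0 ?subr_ge0// mulr_gt0// mulr_gt0.
Qed.

Lemma ler_euclid_normD (R : realType) (n : nat) (u v : 'cV[R]_n) :
  euclid_norm (u + v) <= euclid_norm u + euclid_norm v.
Proof.
rewrite -ler_sqr ?nnegrE ?addr_ge0 ?euclid_norm_ge0//.
have E (w : 'cV[R]_n) : euclid_norm w ^+ 2 = \sum_i w i 0 ^+ 2.
  by rewrite sqr_sqrtr//; apply: sumr_ge0 => i _; exact: sqr_ge0.
rewrite sqrrD !E.
have -> : \sum_i (u + v) i 0 ^+ 2 = \sum_i u i 0 ^+ 2 +
    (\sum_i u i 0 * v i 0) *+ 2 + \sum_i v i 0 ^+ 2.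
  rewrite -sumrMnl -!big_split; apply: eq_bigr => i _ /=.
  by rewrite mxE sqrrD.
by rewrite lerD2r lerD2l lerMn2r dot_le_euclid_norm.
Qed.

(** * Orthogonal matrices and the QR decomposition *)

Lemma orthogonal_mx_tr (R : realType) (n : nat) (Q : 'M[R]_n) :
  orthogonal_mx Q -> orthogonal_mx Q^T.
Proof. by move=> /mulmx1C; rewrite /orthogonal_mx trmxK. Qed.

Lemma orthogonal_mxM (R : realType) (n : nat) (P Q : 'M[R]_n) :
  orthogonal_mx P -> orthogonal_mx Q -> orthogonal_mx (P *m Q).
Proof.
move=> oP oQ.
by rewrite /orthogonal_mx trmx_mul mulmxA -(mulmxA Q^T) oP mulmx1 oQ.
Qed.

Lemma orthogonal_mx_perm (R : realType) (n : nat) (s : 'S_n) :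
  orthogonal_mx (perm_mx s : 'M[R]_n).
Proof. by rewrite /orthogonal_mx tr_perm_mx -perm_mxM mulVg perm_mx1. Qed.

Lemma euclid_norm_orthogonal (R : realType) (n : nat) (Q : 'M[R]_n)
    (v : 'cV[R]_n) :
  orthogonal_mx Q -> euclid_norm (Q *m v) = euclid_norm v.
Proof.
move=> oQ; apply/eqP; rewrite -(eqrXn2 (_ : 0 < 2)%N) ?euclid_norm_ge0//.
by rewrite !sqr_euclid_norm trmx_mul mulmxA -(mulmxA v^T) oQ mulmx1.
Qed.

Lemma normr_det_orthogonal (R : realType) (n : nat) (Q : 'M[R]_n) :
  orthogonal_mx Q -> `|\det Q| = 1.
Proof.
move=> /(congr1 determinant); rewrite det_mulmx det_tr det1 -expr2 => /eqP.
by rewrite -real_normK ?num_real// sqrp_eq1// => /eqP.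
Qed.

(* The reflection exchanging v and |v| e_0. *)
Lemma householder (R : realType) (n : nat) (v : 'cV[R]_(1 + n)) :
  exists2 Q : 'M[R]_(1 + n), orthogonal_mx Q &
    Q *m v = col_mx (euclid_norm v)%:M 0.
Proof.
pose e : 'cV[R]_(1 + n) := col_mx (euclid_norm v)%:M 0.
pose w := v - e.
have [w0|w0] := eqVneq w 0.
  exists 1%:M; first by rewrite /orthogonal_mx trmx1 mulmx1.
  by rewrite mul1mx; apply/eqP; rewrite -subr_eq0 -/e -/w w0.
pose ww := euclid_norm w ^+ 2.
have ww0 : ww != 0 by rewrite expf_eq0 euclid_norm_eq0.
have wwE : w^T *m w = ww%:M.
  by rewrite [LHS]mx11_scalar -sqr_euclid_norm.
pose W := w *m w^T; pose t := 2 / ww; pose Q := 1%:M - t *: W.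
have WW : W *m W = ww *: W.
  by rewrite /W mulmxA -(mulmxA w) wwE mul_mx_scalar -scalemxAl.
have Qsym : Q^T = Q.
  by rewrite /Q linearB /= linearZ /= trmx_mul trmxK trmx1.
exists Q.
  rewrite /orthogonal_mx Qsym /Q mulmxBl mul1mx mulmxBr mulmx1.
  rewrite -scalemxAl -scalemxAr WW !scalerA.
  have -> : t * t * ww = t + t by rewrite /t; field.
  by rewrite scalerDl opprB addrK subrK.
(* As [e] and [v] have the same norm, twice the product of [w] and [v] is the square of the norm of
   [w]; hence [Q] subtracts exactly [w] from [v]. *)
have wv : 2 *: (w^T *m v) = ww%:M.
  have ee : e^T *m e = v^T *m v.
    rewrite [RHS]mx11_scalar -sqr_euclid_norm /e tr_col_mx mul_row_col.
    by rewrite trmx0 mul0mx addr0 tr_scalar_mx -scalar_mxM expr2.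
  have ev : e^T *m v = v^T *m e.
    by rewrite [RHS]mx11_scalar -tr_scalar_mx -mx11_scalar trmx_mul trmxK.
  rewrite -wwE /w [(v - e)^T]linearB /= !mulmxBl !mulmxBr ee ev.
  by rewrite scaler_nat mulr2n opprB.
rewrite /Q mulmxBl mul1mx -scalemxAl -mulmxA.
have -> : w^T *m v = (ww / 2)%:M.
  have two0 : 2 != 0 :> R by rewrite pnatr_eq0.
  apply: (scalerI two0); rewrite wv.
  by rewrite scale_scalar_mx mulrC divfK ?pnatr_eq0.
rewrite mul_mx_scalar scalerA.
have -> : t * (ww / 2) = 1 by rewrite /t; field.
by rewrite scale1r /w subKr.
Qed.

(** A reflection clears the first column below its top entry, and the induction continues in the
    lower right block. The diagonal entries are norms, hence nonnegative. The transpose appears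
    because [is_trig_mx] means lower triangular. *)
Lemma qr_decomposition (R : realType) (n : nat) (M : 'M[R]_n) :
  exists2 Q : 'M[R]_n, orthogonal_mx Q &
    is_trig_mx (Q *m M)^T /\ forall i, 0 <= (Q *m M) i i.
Proof.
elim: n M => [|n IH] M.
  exists 1%:M; first by rewrite /orthogonal_mx trmx1 mulmx1.
  by split=> [|[]//]; apply/is_trig_mxP => -[].
change 'M[R]_(1 + n) in M.
change (exists2 Q : 'M[R]_(1 + n), orthogonal_mx Q &
  is_trig_mx (Q *m M)^T /\ forall i, 0 <= (Q *m M) i i).
have [H oH Hv] := householder (lsubmx M).
have [P oP [tP P0]] := IH (drsubmx (H *m M)).
pose P' : 'M[R]_(1 + n) := block_mx 1%:M 0 0 P.
have oP' : orthogonal_mx P'.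
  rewrite /orthogonal_mx tr_block_mx mulmx_block !trmx0 trmx1.
  by rewrite !(mul0mx, mulmx0, mul1mx, addr0, add0r) oP -scalar_mx_block.
have HM : H *m M = block_mx (euclid_norm (lsubmx M))%:M (ursubmx (H *m M))
    0 (drsubmx (H *m M)).
  rewrite block_mxEh -Hv mulmx_lsub -[LHS]hsubmxK; congr row_mx.
  by rewrite -[LHS]vsubmxK; congr col_mx; apply/matrixP => i j; rewrite !mxE.
have PHM : P' *m H *m M = block_mx (euclid_norm (lsubmx M))%:M
    (ursubmx (H *m M)) 0 (P *m drsubmx (H *m M)).
  rewrite -mulmxA HM mulmx_block !block_mxKur !block_mxKdr.
  by rewrite !(mul0mx, mulmx0, mul1mx, addr0, add0r).
exists (P' *m H); first exact: orthogonal_mxM.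
rewrite PHM; split.
  by rewrite tr_block_mx trmx0 is_trig_block_mx// eqxx tr_scalar_mx
    scalar_mx_is_trig tP.
move=> i; rewrite -(fintype.splitK i); case: (fintype.split i) => j /=.
  by rewrite block_mxEul mxE ord1 euclid_norm_ge0.
by rewrite block_mxEdr.
Qed.

(* Equality case of AM-GM, from ((1 + u) / 2) ^ 2 = u + ((u - 1) / 2) ^ 2. *)
Lemma prod_midpoint1_le1 (R : realFieldType) (n : nat) (u : 'I_n -> R) :
  (forall i, 0 <= u i) -> \prod_i u i = 1 ->
  \prod_i ((1 + u i) / 2) <= 1 -> forall i, u i = 1.
Proof.
move=> u0 u1 leu j; apply/eqP; apply/negPn/negP => uj.
have f_ge i : u i <= ((1 + u i) / 2) ^+ 2.
  have -> : ((1 + u i) / 2) ^+ 2 = u i + ((u i - 1) / 2) ^+ 2 by field.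
  by rewrite lerDl sqr_ge0.
have fj : u j < ((1 + u j) / 2) ^+ 2.
  have -> : ((1 + u j) / 2) ^+ 2 = u j + ((u j - 1) / 2) ^+ 2 by field.
  rewrite ltrDl lt0r sqr_ge0 andbT sqrf_eq0 mulf_neq0//.
  by rewrite subr_eq0.
(* The other factors have a positive product, so the strict inequality at [j] survives the
   multiplication. *)
have prest : 0 < \prod_(i | i != j) u i.
  rewrite lt0r prodr_ge0// andbT; apply: contra_eq_neq u1 => p0.
  by rewrite (bigD1 j)//= p0 mulr0 eq_sym oner_neq0.
have : (\prod_i ((1 + u i) / 2)) ^+ 2 <= 1.
  by rewrite expr_le1// prodr_ge0// => i _; rewrite divr_ge0// addr_ge0.
rewrite -prodrXl leNgt => /negP; apply.
rewrite -[ltLHS]u1 (bigD1 j)//= [ltRHS](bigD1 j)//=.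
apply: (@lt_le_trans _ _ (((1 + u j) / 2) ^+ 2 * \prod_(i | i != j) u i)).
  by rewrite ltr_pM2r.
by rewrite ler_pM2l ?(le_lt_trans (u0 j))// ler_prod// => i _; rewrite u0 f_ge.
Qed.

(** * The Euclidean diameter *)

(** Transfers boundedness of compact sets from the sup norm to the Euclidean norm. *)
Lemma euclid_norm_le_norm (R : realType) (n : nat) (v : 'cV[R]_n) :
  euclid_norm v <= Num.sqrt (n%:R * `|v| ^+ 2).
Proof.
apply: ler_wsqrtr; have -> : n%:R * `|v| ^+ 2 = \sum_(i < n) `|v| ^+ 2.
  by rewrite sumr_const card_ord mulr_natl.
apply: ler_sum => i _; rewrite -real_normK ?num_real// ler_sqr ?nnegrE//.
rewrite [leRHS]mx_normrE.
by apply: (@le_bigmax _ _ _ _ (fun ij : 'I_n * 'I_1 => `|v ij.1 ij.2|) (i, 0)).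
Qed.

(** The bound [d] ensures that [sup] is a genuine supremum and not its default value. *)
Lemma euclid_norm_le_diameter (R : realType) (n : nat) (K : set 'cV[R]_n) (d : R)
    (x y : 'cV[R]_n) :
  (forall x y, K x -> K y -> euclid_norm (x - y) <= d) -> K x -> K y ->
  euclid_norm (x - y) <= diameter K.
Proof.
move=> Kd Kx Ky; apply: ub_le_sup; last by exists x => //; exists y.
by exists d => _ [a Ka [b Kb <-]]; exact: Kd.
Qed.

Lemma diameter_le (R : realType) (n : nat) (K : set 'cV[R]_n) (d : R) :
  K !=set0 -> (forall x y, K x -> K y -> euclid_norm (x - y) <= d) ->
  diameter K <= d.
Proof.
move=> [x Kx] Kd; apply: ge_sup; last first.
  by move=> _ [a Ka [b Kb <-]]; exact: Kd.
by exists (euclid_norm (x - x)); exists x => //; exists x.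
Qed.

Lemma compact_le_diameter (R : realType) (n : nat) (K : set 'cV[R]_n)
    (x y : 'cV[R]_n) :
  compact K -> K x -> K y -> euclid_norm (x - y) <= diameter K.
Proof.
move=> cK; have [M [_ HM]] := compact_bounded cK.
have {}HM z : K z -> `|z| <= `|M| + 1.
  by apply: HM; rewrite (le_lt_trans (ler_norm _))// ltrDl.
apply: (@euclid_norm_le_diameter _ _ _
  (Num.sqrt (n%:R * ((`|M| + 1) *+ 2) ^+ 2))) => a b Ka Kb.
apply: le_trans (euclid_norm_le_norm _) _; apply: ler_wsqrtr.
rewrite ler_wpM2l// ler_sqr ?nnegrE ?mulrn_wge0 ?addr_ge0//.
by rewrite (le_trans (ler_normB _ _))// mulr2n lerD// HM.
Qed.

(** In positive dimension an interior point can be moved by [r / 2] in all coordinates without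
    leaving the body. *)
Lemma diameter_gt0 (R : realType) (n : nat) (K : set 'cV[R]_n.+1) :
  compact K -> K° !=set0 -> 0 < diameter K.
Proof.
move=> cK [c /nbhs_ballP[r /= r0 rK]].
have Kc : K c by apply: rK; exact: ballxx.
have r20 : 0 < r / 2 by rewrite divr_gt0.
pose c' := c + const_mx (r / 2).
have Kc' : K c'.
  apply: rK; split=> // i j; rewrite /ball /= !mxE opprD addrA subrr sub0r normrN.
  by rewrite gtr0_norm// ltr_pdivrMr// ltr_pMr// ltr1n.
apply: lt_le_trans (compact_le_diameter cK Kc' Kc).
rewrite lt0r euclid_norm_ge0 andbT euclid_norm_eq0 /c' addrAC subrr add0r.
by apply/eqP => /matrixP/(_ 0 0); rewrite !mxE => /eqP; rewrite gt_eqF.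
Qed.

(** * Linear maps that do not increase the diameter of a body in Behrend position *)

(** The image under [N] has volume [|det N|] times that of [K] and no larger diameter, so
    [|det N| > 1] would contradict the maximality of [idq K]. *)
Lemma behrend_det_le1 (R : realType) (n : nat) (K : set 'cV[R]_n.+1)
    (N : 'M[R]_n.+1) :
  behrend_position K -> N \in unitmx ->
  (forall x y, K x -> K y -> euclid_norm (N *m (x - y)) <= diameter K) ->
  `|\det N| <= 1.
Proof.
move=> [[cK _ iK] [_ maxK]] uN NK.
have mK := measurable_col_compact cK.
have [v v0 vE] := volume_compact_interior cK iK.
have d0 := diameter_gt0 cK iK.
set NKs := linear_image N K.
have NKd x y : NKs x -> NKs y -> euclid_norm (x - y) <= diameter K.
  by move=> [a Ka <-] [b Kb <-]; rewrite -mulmxBr; exact: NK.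
(* Two distinct points have distinct images under [N], so the diameter of the image is positive and
   can be divided by. *)
have [a [b [Ka Kb ab]]] : exists a b, [/\ K a, K b & a != b].
  apply: contrapT => /forallNP nab.
  suff : diameter K <= 0 by rewrite leNgt d0.
  have [k /interior_subset Kk] := iK.
  apply: diameter_le; first by exists k.
  move=> x y Kx Ky; rewrite (_ : x - y = 0) ?(eqP (etrans (euclid_norm_eq0 0) (eqxx _)))//.
  apply/eqP; rewrite subr_eq0; apply: contrapT => /negP xy.
  by have /forallNP/(_ y) := nab x; apply.
have dN0 : 0 < diameter NKs.
  apply: (@lt_le_trans _ _ (euclid_norm (N *m a - N *m b))).
    rewrite lt0r euclid_norm_ge0 andbT euclid_norm_eq0 subr_eq0.
    by apply: contra ab => /eqP/(can_inj (mulKmx uN)) ->.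
  by apply: (euclid_norm_le_diameter NKd); [exists a|exists b].
have dN : diameter NKs <= diameter K.
  by apply: diameter_le => //; exists (N *m a); exists a.
have : idq NKs <= idq K by apply: maxK; exists N.
rewrite /idq volume_linear_image// vE /=.
rewrite ler_pdivrMr ?exprn_gt0// => H.
have : `|\det N| * v <= v.
  apply: le_trans H _; rewrite -mulrA ler_piMr ?(ltW v0)//.
  rewrite mulrC ler_pdivrMr ?exprn_gt0// mul1r.
  by rewrite lerXn2r// ?nnegrE ltW.
by rewrite ger_pMl.
Qed.

Lemma det_upper_trig (R : comPzRingType) (n : nat) (U : 'M[R]_n) :
  is_trig_mx U^T -> \det U = \prod_i U i i.
Proof.
by move=> tU; rewrite -det_tr det_trig//; apply: eq_bigr => i _; rewrite mxE.
Qed.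

(** The orthogonal factors change neither lengths nor [|det|], so the determinant bound for the
    midpoint of [M] and an orthogonal matrix becomes a bound on the product of the midpoints of 1
    and the diagonal entries. *)
Lemma behrend_qr_diag1 (R : realType) (n : nat) (K : set 'cV[R]_n.+1)
    (M P Q : 'M[R]_n.+1) :
  behrend_position K -> `|\det M| = 1 ->
  (forall x y, K x -> K y -> euclid_norm (M *m (x - y)) <= diameter K) ->
  orthogonal_mx P -> orthogonal_mx Q ->
  is_trig_mx (Q *m (M *m P))^T -> (forall i, 0 <= (Q *m (M *m P)) i i) ->
  forall i, (Q *m (M *m P)) i i = 1.
Proof.
move=> bK detM MK oP oQ; set U := Q *m (M *m P) => tU U0.
have detU : \prod_i U i i = 1.
  have <- : `|\det U| = \prod_i U i i.
    by rewrite det_upper_trig// ger0_norm// prodr_ge0.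
  by rewrite /U !det_mulmx !normrM detM !normr_det_orthogonal// !mul1r.
have ME : M = Q^T *m U *m P^T.
  by rewrite /U mulmxA oQ mul1mx -mulmxA (mulmx1C oP) mulmx1.
(* The midpoint of 1 and [U] is still upper triangular; [N] below is its transport back through [Q]
   and [P]. *)
clearbody U; pose T := 2^-1 *: (1%:M + U).
have detT : \det T = \prod_i ((1 + U i i) / 2).
  rewrite det_upper_trig; last first.
    apply/is_trig_mxP => i j ij; rewrite !mxE eq_sym.
    rewrite (_ : (i == j) = false) ?add0r; last by rewrite -val_eqE ltn_eqF.
    by have := is_trig_mxP tU i j ij; rewrite mxE => ->; rewrite mulr0.
  by apply: eq_bigr => i _; rewrite !mxE eqxx mulrC.
have detT0 : 0 < \det T.
  by rewrite detT prodr_gt0// => i _; rewrite divr_gt0// ltr_pwDl.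
pose N := Q^T *m T *m P^T.
have NE : N = 2^-1 *: (Q^T *m P^T + M).
  by rewrite /N /T -scalemxAr -scalemxAl mulmxDr mulmxDl mulmx1 -ME.
have oQP : orthogonal_mx (Q^T *m P^T).
  by apply: orthogonal_mxM; exact: orthogonal_mx_tr.
have detN : `|\det N| = \det T.
  rewrite !det_mulmx !normrM !(normr_det_orthogonal (orthogonal_mx_tr _))//.
  by rewrite mul1r mulr1 gtr0_norm.
apply: prod_midpoint1_le1 => //; rewrite -detT -detN.
apply: behrend_det_le1 (bK) _ _.
  by rewrite unitmxE unitfE -normr_eq0 detN gt_eqF.
move=> x y Kx Ky; rewrite NE -scalemxAl euclid_normZ ger0_norm ?invr_ge0//.
rewrite mulrC ler_pdivrMr// mulr_natr mulr2n mulmxDl.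
apply: le_trans (ler_euclid_normD _ _) _; rewrite lerD ?MK//.
rewrite euclid_norm_orthogonal//.
by apply: compact_le_diameter => //; have [[]] := bK.
Qed.

Lemma behrend_orthogonal (R : realType) (n : nat) (K : set 'cV[R]_n.+1)
    (M : 'M[R]_n.+1) :
  behrend_position K -> `|\det M| = 1 ->
  (forall x y, K x -> K y -> euclid_norm (M *m (x - y)) <= diameter K) ->
  orthogonal_mx M.
Proof.
move=> bK detM MK.
(* The transposition brings column [i] to the front, where triangularity leaves only the diagonal
   entry 1. *)
have col1 i : euclid_norm (col i M) = 1.
  pose P : 'M[R]_n.+1 := tperm_mx 0 i.
  have oP : orthogonal_mx P by exact: orthogonal_mx_perm.
  have [Q oQ [tU U0]] := qr_decomposition (M *m P).
  have U1 := behrend_qr_diag1 bK detM MK oP oQ tU U0.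
  rewrite -(euclid_norm_orthogonal _ oQ) colE mulmxA -colE.
  have -> : col i (Q *m M) = col 0 (Q *m (M *m P)).
    by rewrite mulmxA -xcolE; apply/colP => j; rewrite !mxE tpermL.
  rewrite /euclid_norm (bigD1 0)//= big1 ?addr0 => [|j j0].
    by rewrite mxE U1 expr1n sqrtr1.
  rewrite mxE; have := is_trig_mxP tU 0 j; rewrite lt0n j0 mxE => -> //.
  by rewrite expr0n.
have [Q oQ] := qr_decomposition (M *m 1%:M).
have o1 : orthogonal_mx (1%:M : 'M[R]_n.+1).
  by rewrite /orthogonal_mx trmx1 mulmx1.
move=> [tU U0]; have := behrend_qr_diag1 bK detM MK o1 oQ tU U0.
rewrite mulmx1 in tU U0 *; move=> U1.
have QM : Q *m M = 1%:M.
  apply/matrixP => i j; rewrite [RHS]mxE; have [->|ij] := eqVneq i j.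
    by rewrite U1.
  (* The diagonal entry 1 exhausts the norm of the column, so the squares of its other entries sum
     to zero. *)
  have : euclid_norm (col j (Q *m M)) ^+ 2 = 1.
    by rewrite colE -mulmxA -colE euclid_norm_orthogonal// col1 expr1n.
  rewrite sqr_sqrtr; last by apply: sumr_ge0 => k _; exact: sqr_ge0.
  rewrite (bigD1 j)//= mxE U1 expr1n => /(canRL (addKr _)); rewrite addNr.
  move=> /eqP; rewrite psumr_eq0 => [|k _]; last exact: sqr_ge0.
  move=> /allP/(_ i (mem_index_enum i)); rewrite ij /= mxE sqrf_eq0.
  by move=> /eqP ->.
have -> : M = Q^T by rewrite -[LHS]mul1mx -oQ -mulmxA QM mulmx1.
exact: orthogonal_mx_tr.
Qed.

(** * Uniqueness of the Behrend position *)

Theorem proposition2p7 (R : realType) (n : nat) (K : set 'cV[R]_n)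
    (A B : 'M[R]_n) (hK : convex_body K)
    (hA : A \in unitmx) (hB : B \in unitmx)
    (hAK : behrend_position (linear_image A K))
    (hBK : behrend_position (linear_image B K)) :
  exists (Q : 'M[R]_n) (rho : R) (t : 'cV[R]_n),
    [/\ orthogonal_mx Q, 0 < rho &
      linear_image B K = [set rho *: (Q *m x) + t | x in linear_image A K]].
Proof.
(* In dimension 0 all vectors coincide and the diameter vanishes, so this case is settled before
   dividing by it. *)
case: n => [|n] in K A B hK hA hB hAK hBK *.
  exists 1%:M, 1, 0; split=> //; first by rewrite /orthogonal_mx trmx1 mulmx1.
  rewrite [B]flatmx0 [A]flatmx0; apply/seteqP; split=> [x Lx|_ [x Lx <-]].
    by exists x => //; rewrite [LHS]flatmx0 [x]flatmx0.
  by rewrite (_ : _ + _ = x)// [LHS]flatmx0 [RHS]flatmx0.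
set L := linear_image A K in hAK *.
pose M0 := B *m invmx A.
have uM0 : M0 \in unitmx by rewrite unitmx_mul hB unitmx_inv.
have LB : linear_image B K = linear_image M0 L.
  by rewrite /L linear_imageM /M0 mulmxKV.
have [[cL _ iL] [_ maxL]] := hAK.
have [[cBK _ iBK] [_ maxBK]] := hBK.
have [v v0 vE] := volume_compact_interior cL iL.
have d0 := diameter_gt0 cL iL.
have dB0 := diameter_gt0 cBK iBK.
(* Each body is a linear image of the other, so each maximum bounds the other. *)
have idqE : idq (linear_image B K) = idq L.
  have LE : linear_image (invmx M0) (linear_image B K) = L.
    rewrite LB linear_imageM mulVmx//; apply/seteqP.
    by split=> [_ [x Lx <-]|x Lx]; [rewrite mul1mx|exists x; rewrite ?mul1mx].
  apply/eqP; rewrite eq_le; apply/andP; split.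
    by apply: maxL; exists M0; rewrite ?LB.
  by apply: maxBK; exists (invmx M0); rewrite /= ?LE ?unitmx_inv.
set d := diameter L in d0.
set dB := diameter (linear_image B K) in dB0.
have detM0 : `|\det M0| = (dB / d) ^+ n.+1.
  move: idqE; rewrite /idq -/d -/dB {1}LB volume_linear_image//; last first.
    exact: measurable_col_compact.
  rewrite vE /= => /(congr1 (fun r => r * dB ^+ n.+1 / v)).
  rewrite divfK ?expf_neq0 ?gt_eqF// mulfK ?gt_eqF// => ->.
  by rewrite expr_div_n; field; rewrite !gt_eqF// exprn_gt0.
(* Dividing [M0] by the ratio of the diameters normalizes both the diameter of the image and, by
   [detM0], the determinant. *)
pose rho := dB / d.
have rho0 : 0 < rho by rewrite divr_gt0.
pose M := rho^-1 *: M0.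
have oM : orthogonal_mx M.
  apply: behrend_orthogonal hAK _ _.
    rewrite /M detZ normrM detM0 normrX gtr0_norm ?invr_gt0// -exprMn.
    by rewrite mulVf ?expr1n// gt_eqF.
  move=> x y Lx Ly; rewrite /M -scalemxAl euclid_normZ gtr0_norm ?invr_gt0//.
  rewrite ler_pdivrMl// /rho divfK ?gt_eqF// mulmxBr -/dB.
  by apply: compact_le_diameter => //; rewrite LB; [exists x|exists y].
(* The translation is zero because [M0] maps one body linearly onto the other. *)
exists M, rho, 0; split => //; rewrite LB.
have E x : rho *: (M *m x) + 0 = M0 *m x.
  by rewrite addr0 /M -scalemxAl scalerA divff ?scale1r// gt_eqF.
by apply/seteqP; split => _ [x Lx <-]; exists x => //; rewrite E.
Qed.
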